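(* Let $\Lambda\in(0,1]$, $M\in(0,2\Lambda)$, let $b:(0,1)\to(0,\infty)$ satisfy $\lim_{\varepsilon\to0_+}b(\varepsilon)=\infty$, and suppose that $\Omega=\Omega(\varepsilon)$ satisfies $b(\varepsilon)|\ln\varepsilon|\le\Omega\le M/\varepsilon$ for $\varepsilon\in(0,1)$. Let $\beta>0$ and let $U\subset\mathbb R^2$ be an open set, independent of $\varepsilon$ and $\Omega$, with $|\partial U|=0$ and such that $\overline U\subset\mathcal D_{\varepsilon\Omega}$ and $\mathrm{dist}(U,\partial\mathcal D_{\varepsilon\Omega})\ge\beta$ for all sufficiently small $\varepsilon$. For each such $\varepsilon$ let $v$ be a minimizer of the problem defining $C_0(\varepsilon,\Omega)$, and let $\mu_\varepsilon$ be the vorticity measure of $v$ in $U$ (all these objects being defined in the context). Then $$\frac1\Omega\,\mu_\varepsilon\rightharpoonup \mathbf 1_U\,dx\qquad\text{as }\varepsilon\to0_+$$ weakly in the sense of measures, where $dx$ is the Lebesgue measure on $\mathbb R^2$ and $\mathbf 1_U$ is the characteristic function of $U$.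
   Context: **Functionals.** Put $|x|_\Lambda=\sqrt{x_1^2+\Lambda^2x_2^2}$, $a_0=\sqrt{2\Lambda/\pi}$, $a(x)=a_0-|x|_\Lambda^2$, $a_-(x)=\max(-a(x),0)$, $\mathbf A_0(x)=\tfrac12(-x_2,x_1)$. Let $$E_{\varepsilon,\Omega}(u)=\int_{\mathbb R^2}\left(|\nabla u|^2+\frac1{2\varepsilon^2}\Bigl([a(x)-|u|^2]^2-[a_-(x)]^2\Bigr)-\frac{\Omega^2}{4}|x|^2|u|^2\right)dx$$ and let $\widetilde\eta_{\varepsilon,\Omega}>0$ be a positive minimizer of $E_{\varepsilon,\Omega}$ over $\{u\in H^1(\mathbb R^2): |x|^2u\in L^2(\mathbb R^2),\ \int_{\mathbb R^2}|u|^2dx=1\}$. Write $\widetilde\eta=\widetilde\eta_{\varepsilon,\Omega}$. For complex-valued $v$ set $$\mathcal G_\varepsilon(v)=\int_{\mathbb R^2}\left(\widetilde\eta^2|(\nabla-i\Omega\mathbf A_0)v|^2+\frac{\widetilde\eta^4}{2\varepsilon^2}(1-|v|^2)^2\right)dx,$$ $$C_0(\varepsilon,\Omega)=\inf\Bigl\{\mathcal G_\varepsilon(v): v\in H^1(\mathbb R^2),\ \widetilde\eta\,|x|v\in L^2(\mathbb R^2),\ \int_{\mathbb R^2}\widetilde\eta^2|v|^2dx=1\Bigr\}.$$ This problem is equivalent, via $u=\widetilde\eta v$, to minimizing $$F_\varepsilon(u)=\int_{\mathbb R^2}\left(|(\nabla-i\Omega\mathbf A_0)u|^2+\frac1{2\varepsilon^2}\bigl([a-|u|^2]^2-[a_-]^2\bigr)-\frac{\Omega^2}4|x|^2|u|^2\right)dx$$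 under $\int_{\mathbb R^2}|u|^2dx=1$ with $u\in H^1(\mathbb R^2)$, $|x|^2u\in L^2(\mathbb R^2)$, and $F_\varepsilon(\widetilde\eta v)=E_{\varepsilon,\Omega}(\widetilde\eta)+\mathcal G_\varepsilon(v)$ under the constraint. **Bulk region.** $$\alpha_{\varepsilon\Omega}=a_0\left(\frac{1-\frac{\varepsilon^2\Omega^2}{4\Lambda^2}}{1-\frac{\varepsilon^2\Omega^2}{4}}\right)^{1/4},\qquad \widetilde\Lambda_{\varepsilon\Omega}=\Lambda\left(\frac{1-\frac{\varepsilon^2\Omega^2}{4\Lambda^2}}{1-\frac{\varepsilon^2\Omega^2}{4}}\right)^{1/2},$$ $$\mathcal D_{\varepsilon\Omega}=\{x\in\mathbb R^2:\ \alpha_{\varepsilon\Omega}-x_1^2-\widetilde\Lambda_{\varepsilon\Omega}^2x_2^2>0\}.$$ **Good and bad squares.** Let $\delta=(|\ln\varepsilon|/\Omega)^{1/4}$ (so $\delta\to0$ as $\varepsilon\to0_+$) and let $(\mathcal K_j)_j$ be the lattice of squares tiling $\mathbb R^2$ generated by $\mathcal K=(-\delta/2,\delta/2)\times(-\delta/2,\delta/2)$; $x_j$ is the center of $\mathcal K_j$. Put $$\mathrm{GL}_\varepsilon(v;\mathcal K_j)=\int_{\mathcal K_j}\left(|(\nabla-i\Omega\mathbf A_0)v|^2+\frac{\widetilde\eta(x_j)^2}{2\varepsilon^2}(1-|v|^2)^2\right)dx.$$ Fix a positive function $g(\varepsilon)\to0$ as $\varepsilon\to0_+$ such that, for all squares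 $\mathcal K_j\subset U$, $\mathrm{GL}_\varepsilon(v;\mathcal K_j)\ge(1-g(\varepsilon))\,\Omega\,\delta^2\ln\frac1{\varepsilon\sqrt\Omega}$. A square $\mathcal K_j\subset U$ is good if $\mathrm{GL}_\varepsilon(v;\mathcal K_j)\le(1+\sqrt{g(\varepsilon)})\,\Omega\,\delta^2\ln\frac1{\varepsilon\sqrt\Omega}$, and bad otherwise; the number $N_{\rm b}$ of bad squares and the number $N_{\rm g}$ of good squares satisfy $N_{\rm b}/N_{\rm g}\to0$ as $\varepsilon\to0_+$. Such a $g$ exists. **Vortex discs.** There exist a constant $C>0$ and a positive function $\hat g(\varepsilon)\to0$ as $\varepsilon\to0_+$ such that for every good square $\mathcal K_j$ there is a finite family of discs $(B(a_{i,j},r_{i,j}))_i$ with: (1) $\sum_i r_{i,j}\le C\,\Omega^{-1/2}$; (2) $\{x\in\mathcal K_j: |v(x)|<\tfrac12\}\subset\bigcup_iB(a_{i,j},r_{i,j})$; (3) if $d_{i,j}$ is the winding number of $v/|v|$ on $\partial B(a_{i,j},r_{i,j})$ when $B(a_{i,j},r_{i,j})\subset\mathcal K_j$ and $d_{i,j}=0$ otherwise, then $\sum_id_{i,j}\ge\Omega\delta^2(1-\hat g(\varepsilon))$ and $\sum_i|d_{i,j}|\le\Omega\delta^2(1+\hat g(\varepsilon))$. (The existence of such families is taken from a proposition of Sandier and Serfaty.) Fix such families. **Vorticity measure.** With $\mathcal J_{\rm g}$ the set of indices $j$ such that $\mathcal K_j$ is a good square and $\mathcal K_j\subset U$, the vorticity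 measure in $U$ is $$\mu_\varepsilon=\sum_{j\in\mathcal J_{\rm g}}\sum_i d_{i,j}\,\delta_{a_{i,j}},$$ where $\delta_{a}$ is the Dirac mass at $a$. Weak convergence means $\frac1\Omega\int\varphi\,d\mu_\varepsilon\to\int_U\varphi\,dx$ for every continuous compactly supported $\varphi$ on $\mathbb R^2$. *)

(* Defs.v *)
From HB Require Import structures.
From mathcomp Require Import all_boot all_order all_algebra.
From mathcomp Require Import finmap.
From mathcomp Require Import all_classical all_reals all_analysis.
From mathcomp Require Import complex.

Set Implicit Arguments.
Unset Strict Implicit.
Unset Printing Implicit Defensive.

Import Order.TTheory GRing.Theory Num.Theory.
Import numFieldNormedType.Exports.

Local Open Scope classical_set_scope.
Local Open Scope ring_scope.
Local Open Scope complex_scope.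

(* [lebesgue_measure] lives on [measurableTypeR R], whose measurable structure
   is not the one inferred for [R]; topologically both are [R]. *)
Definition plane (R : realType) : Type :=
  (measurableTypeR R * measurableTypeR R)%type.

Definition leb2 (R : realType) : {measure set (plane R) -> \bar R} :=
  (@lebesgue_measure R \x @lebesgue_measure R)%E.

Section plane_geometry.
Context (R : realType).
Implicit Types (x y a : plane R) (A B : set (plane R)) (r : R).

(* The norm of the product type [R * R] is the sup norm. *)
Definition enorm x : R := Num.sqrt (x.1 ^+ 2 + x.2 ^+ 2).

Definition eucl_dist x y : R := enorm (x.1 - y.1, x.2 - y.2).

Definition disc a r : set (plane R) := [set x | eucl_dist x a < r].

Definition bdry A : set (plane R) := closure A `\` interior A.

Definition set_dist A B : \bar R :=
  ereal_inf [set d | exists x y, [/\ A x, B y & d = (eucl_dist x y)%:E]].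

End plane_geometry.

Section sobolev.
Context (R : realType).
Implicit Types (phi f h : plane R -> R) (u w : plane R -> R[i]) (k : 'I_2).

Definition unit_vec k : R * R := ((k == 0)%:R, (k == 1)%:R).

Definition iter_partial phi (s : seq 'I_2) : plane R -> R :=
  foldr (fun k f => fun x => 'D_(unit_vec k) f x) phi s.

Definition smooth phi : Prop := forall s : seq 'I_2,
  continuous (iter_partial phi s) /\
  forall x k, derivable (iter_partial phi s) x (unit_vec k).

Definition compactly_supported phi : Prop :=
  compact (closure [set x : plane R | phi x != 0]).

Definition test_function phi : Prop := smooth phi /\ compactly_supported phi.

Definition weak_partial k f h : Prop := forall phi, test_function phi ->
  (\int[leb2 R]_x (f x * 'D_(unit_vec k) phi x)%:E
   = - \int[leb2 R]_x (h x * phi x)%:E)%E.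

Definition L2 u : Prop :=
  (fun x => complex.Re (u x)) \in Lfun (leb2 R) 2%:E /\
  (fun x => complex.Im (u x)) \in Lfun (leb2 R) 2%:E.

Definition is_wderiv k u w : Prop :=
  [/\ L2 w,
      weak_partial k (fun x => complex.Re (u x)) (fun x => complex.Re (w x))
    & weak_partial k (fun x => complex.Im (u x)) (fun x => complex.Im (w x))].

Definition H1 u : Prop := L2 u /\ forall k, exists w, is_wderiv k u w.

(* A representative of the weak derivative of an H^1 function; it is unique up
   to null sets and only enters through Lebesgue integrals. *)
Definition wderiv k u : plane R -> R[i] := xget (fun=> 0) [set w | is_wderiv k u w].

Definition sqmod (z : R[i]) : R := ComplexField.Normc.normc z ^+ 2.

Definition sqgrad u (x : plane R) : R := \sum_(k < 2) sqmod (wderiv k u x).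

End sobolev.

Section functionals.
Context (R : realType).
Implicit Types (Lambda eps Om delta r : R) (x : plane R).
Implicit Types (u v : plane R -> R[i]) (eta : plane R -> R).

Definition Lnorm2 Lambda x : R := Num.sqrt (x.1 ^+ 2 + Lambda ^+ 2 * x.2 ^+ 2).

Definition a0 Lambda : R := Num.sqrt (2 * Lambda / pi).

Definition afun Lambda x : R := a0 Lambda - Lnorm2 Lambda x ^+ 2.

Definition afun_minus Lambda x : R := Num.max (- afun Lambda x) 0.

Definition A0 (k : 'I_2) x : R := if k == 0 then - x.2 / 2 else x.1 / 2.

Definition sqcovgrad Om v x : R :=
  \sum_(k < 2) sqmod (wderiv k v x - (0 +i* (Om * A0 k x)) * v x).

Definition Efun Lambda eps Om u : \bar R :=
  (\int[leb2 R]_x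
     (sqgrad u x
      + (2 * eps ^+ 2)^-1
        * ((afun Lambda x - sqmod (u x)) ^+ 2 - afun_minus Lambda x ^+ 2)
      - Om ^+ 2 / 4 * enorm x ^+ 2 * sqmod (u x))%:E)%E.

Definition Eadm u : Prop :=
  [/\ H1 u, L2 (fun x => (enorm x ^+ 2)%:C * u x)
    & (\int[leb2 R]_x (sqmod (u x))%:E = 1)%E].

Definition minimizer (J : (plane R -> R[i]) -> \bar R)
    (adm : set (plane R -> R[i])) u : Prop :=
  adm u /\ J u = ereal_inf [set J w | w in adm].

(* Continuity selects the representative whose point values enter [GL]. *)
Definition positive_minimizer Lambda eps Om eta : Prop :=
  [/\ continuous eta, forall x, 0 < eta x
    & minimizer (Efun Lambda eps Om) Eadm (fun x => (eta x)%:C)].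

Definition Gfun eta eps Om v : \bar R :=
  (\int[leb2 R]_x
     (eta x ^+ 2 * sqcovgrad Om v x
      + eta x ^+ 4 / (2 * eps ^+ 2) * (1 - sqmod (v x)) ^+ 2)%:E)%E.

Definition Gadm eta v : Prop :=
  [/\ H1 v, L2 (fun x => (eta x * enorm x)%:C * v x)
    & (\int[leb2 R]_x (eta x ^+ 2 * sqmod (v x))%:E = 1)%E].

Definition C0 eta eps Om : \bar R :=
  ereal_inf [set Gfun eta eps Om v | v in Gadm eta].

(* Continuity selects the representative whose level sets and winding numbers
   define the vortices. *)
Definition C0_minimizer eta eps Om v : Prop :=
  [/\ continuous (fun x => complex.Re (v x)), continuous (fun x => complex.Im (v x)),
      Gadm eta v & Gfun eta eps Om v = C0 eta eps Om].

Definition bulk_ratio Lambda eps Om : R :=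
  (1 - eps ^+ 2 * Om ^+ 2 / (4 * Lambda ^+ 2)) / (1 - eps ^+ 2 * Om ^+ 2 / 4).

Definition bulk_alpha Lambda eps Om : R :=
  a0 Lambda * bulk_ratio Lambda eps Om `^ (4^-1).

Definition bulk_Lambda Lambda eps Om : R :=
  Lambda * bulk_ratio Lambda eps Om `^ (2^-1).

Definition bulk Lambda eps Om : set (plane R) :=
  [set x | 0 < bulk_alpha Lambda eps Om - x.1 ^+ 2
               - bulk_Lambda Lambda eps Om ^+ 2 * x.2 ^+ 2].

End functionals.

Section squares.
Context (R : realType).
Implicit Types (eps Om delta r gam : R) (j : int * int) (U : set (plane R)).
Implicit Types (v : plane R -> R[i]) (eta : plane R -> R).

Definition side eps Om : R := (`|ln eps| / Om) `^ (4^-1).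

Definition sq_center delta j : plane R := (delta * j.1%:~R, delta * j.2%:~R).

Definition square delta j : set (plane R) :=
  [set x | `|x.1 - (sq_center delta j).1| < delta / 2 /\
           `|x.2 - (sq_center delta j).2| < delta / 2].

Definition GL eta eps Om v j : \bar R :=
  let delta := side eps Om in
  (\int[leb2 R]_(x in square delta j)
     (sqcovgrad Om v x
      + eta (sq_center delta j) ^+ 2 / (2 * eps ^+ 2)
        * (1 - sqmod (v x)) ^+ 2)%:E)%E.

Definition GLscale eps Om : R :=
  Om * side eps Om ^+ 2 * ln (1 / (eps * Num.sqrt Om)).

Definition squares_in U eps Om : set (int * int) :=
  [set j | square (side eps Om) j `<=` U].

(* [gam] stands for the value g(eps). *)
Definition good_squares U eta eps Om v gam : set (int * int) :=
  [set j | squares_in U eps Om j /\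
    (GL eta eps Om v j <= ((1 + Num.sqrt gam) * GLscale eps Om)%:E)%E].

Definition bad_squares U eta eps Om v gam : set (int * int) :=
  squares_in U eps Om `\` good_squares U eta eps Om v gam.

(* For a finite set; the squares contained in a bounded set are finitely many. *)
Definition square_count (J : set (int * int)) : R := #|` fset_set J|%:R.

(* Nb / Ng -> 0 at 0+, without dividing by Ng: an empty set contains no
   squares, and then Nb = Ng = 0. *)
Definition ratio_vanishes (Nb Ng : R -> R) : Prop :=
  forall e, 0 < e -> \forall eps \near 0^'+, Nb eps <= e * Ng eps.

End squares.

Section vortices.
Context (R : realType).
Implicit Types (v : plane R -> R[i]) (a : plane R) (r Om delta C gam : R).

Definition vdisc : Type := (plane R * R * int)%type.
Definition vcenter (B : vdisc) : plane R := B.1.1.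
Definition vradius (B : vdisc) : R := B.1.2.
Definition vdegree (B : vdisc) : int := B.2.
Definition vball (B : vdisc) : set (plane R) := disc (vcenter B) (vradius B).

Definition circle a r (t : R) : plane R := (a.1 + r * cos t, a.2 + r * sin t).

(* The equation forces v to be nonzero on the circle. *)
Definition winding_number v a r (d : int) : Prop :=
  exists theta : R -> R,
    [/\ {within `[0, 2 * pi], continuous theta},
        forall t, 0 <= t <= 2 * pi ->
          v (circle a r t) / (ComplexField.Normc.normc (v (circle a r t)))%:C
          = cos (theta t) +i* sin (theta t)
      & theta (2 * pi) - theta 0 = 2 * pi * d%:~R].

Definition vdegree_spec (K : set (plane R)) v (B : vdisc) : Prop :=
  (vball B `<=` K -> winding_number v (vcenter B) (vradius B) (vdegree B)) /\
  (~ (vball B `<=` K) -> vdegree B = 0).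

(* [gam] stands for the value of the error function at eps. *)
Definition vortex_family v Om delta C gam (j : int * int) (s : seq vdisc) : Prop :=
  [/\ forall B, B \in s -> 0 < vradius B /\ vdegree_spec (square delta j) v B,
      \sum_(B <- s) vradius B <= C * Om `^ (- 2^-1),
      [set x | square delta j x /\ ComplexField.Normc.normc (v x) < 1 / 2]
        `<=` [set x | exists2 B, B \in s & vball B x],
      Om * delta ^+ 2 * (1 - gam) <= (\sum_(B <- s) vdegree B)%:~R
    & (\sum_(B <- s) `|vdegree B|)%:~R <= Om * delta ^+ 2 * (1 + gam)].

Definition charge_add (n1 n2 : {charge set (plane R) -> \bar R}) :
  {charge set (plane R) -> \bar R} := cadd n1 n2.

Definition zero_charge : {charge set (plane R) -> \bar R} := @czero _ _ R.

Definition point_vortex (B : vdisc) : {charge set (plane R) -> \bar R} :=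
  cscale (vdegree B)%:~R (charge_of_finite_measure (@dirac _ _ (vcenter B) R)).

Definition vorticity (J : set (int * int)) (discs : int * int -> seq vdisc) :
    {charge set (plane R) -> \bar R} :=
  \big[charge_add/zero_charge]_(j <- fset_set J)
    \big[charge_add/zero_charge]_(B <- discs j) point_vortex B.

(* The integral against a signed measure is the difference of the integrals
   against its positive and negative parts. *)
Definition charge_integral (nu : {charge set (plane R) -> \bar R})
    (phi : plane R -> R) : \bar R :=
  let hP := cid (Hahn_decomposition nu) in
  let nuPN := svalP (cid (svalP hP)) in
  (\int[jordan_pos nuPN]_x (phi x)%:E - \int[jordan_neg nuPN]_x (phi x)%:E)%E.

End vortices.

(* Main.v *)
Require Import Defs.
From HB Require Import structures.
From mathcomp Require Import all_boot all_order all_algebra.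
From mathcomp Require Import finmap.
From mathcomp Require Import all_classical all_reals all_analysis.
From mathcomp Require Import complex.
From mathcomp Require Import measurable_realfun.
From mathcomp Require Import ring lra.

Set Implicit Arguments.
Unset Strict Implicit.
Unset Printing Implicit Defensive.

Import Order.TTheory GRing.Theory Num.Theory.
Import numFieldNormedType.Exports.

Local Open Scope classical_set_scope.
Local Open Scope ring_scope.

(** The degrees and centres of the vortices are controlled square by square,
    so the convergence is a statement about Riemann sums.

    A disc of nonzero degree lies inside its square, hence so does its centre,
    and on one good square the sum of [d_i phi(a_i)] differs from
    [phi(x_j) * sum d_i] by at most the oscillation of [phi] times [sum |d_i|].
    Both [sum d_i] and [sum |d_i|] equal [Om delta^2] up to a relative error
    [ghat], so this square contributes [delta^2 phi(x_j)] to [mu / Om], with an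
    error that is small relative to [delta^2]
    ([vortex_family_sum_dist_le]).  Since the good squares are disjoint and
    contained in [U], their number times [delta^2] is at most [|U|], and summing
    gives the integral of [phi] over their union up to a vanishing error
    ([riemann_sum_dist_le]).

    It remains to see that the good squares exhaust [U] in measure.  The set [U]
    is bounded, being contained in an ellipse [bulk].  The lattice squares
    contained in a bounded open set cover, once closed, every point at distance
    at least [delta] from the complement, so the measure they miss tends to [0]
    with [delta] ([squares_fill]); and the bad ones among them have total
    measure at most a vanishing fraction of that of the good ones
    ([leb2_sub_good_squares_le]).  The side [delta] tends to [0] because
    [Om / |ln eps|] dominates [b], which tends to infinity ([near_side]).

    The integral against the vorticity is defined through a Hahn decomposition;
    it is turned into a finite sum by showing that any way of writing a charge
    as a difference of two finite measures computes the same integral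
    ([charge_integralE]). *)

(** * Integration against a signed measure *)

Lemma integral_mscale d (T : measurableType d) (R : realType)
    (mu : {measure set T -> \bar R}) (D : set T) (k : {nonneg R})
    (f : T -> \bar R) : measurable D -> mu.-integrable D f ->
  (\int[mscale k mu]_(x in D) f x = k%:num%:E * \int[mu]_(x in D) f x)%E.
Proof.
move=> mD intf; have mf := measurable_int _ intf.
rewrite [X in _ = (_ * X)%E]integralE [X in X = _]integralE !ge0_integral_mscale//.
- apply/esym/muleBr => //; apply: fin_num_adde_defl.
  by rewrite fin_numN integrable_fin_num//; exact: integrable_funeneg.
- exact: measurable_funeneg.
- exact: measurable_funepos.
Qed.

Section charge_integral.
Context (R : realType).
Variable f : plane R -> R.
Hypotheses (mf : measurable_fun setT f) (bf : [bounded f x | x in setT]).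
Implicit Types nu : {charge set (plane R) -> \bar R}.
Local Open Scope ereal_scope.

Lemma bounded_integrable (mu : {measure set (plane R) -> \bar R}) :
  mu setT < +oo -> mu.-integrable setT (EFin \o f).
Proof. by move=> mufin; exact: measurable_bounded_integrable. Qed.

(** With [P - N] the Jordan decomposition, [P + mu2] and [mu1 + N] agree on
    measurable sets, hence give the same integral to [f]. The hypothesis is
    stated as a sum so that no subtraction of infinities can occur. *)
Lemma charge_integralE nu (mu1 mu2 : {measure set (plane R) -> \bar R}) :
  mu1 setT < +oo -> mu2 setT < +oo ->
  (forall A, measurable A -> nu A + mu2 A = mu1 A) ->
  charge_integral nu f = \int[mu1]_x (f x)%:E - \int[mu2]_x (f x)%:E.
Proof.
move=> fin1 fin2 nuE; rewrite /charge_integral.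
set nuPN := svalP (cid (svalP (cid (Hahn_decomposition nu)))).
set P := jordan_pos nuPN; set N := jordan_neg nuPN.
have Pfin : P setT < +oo by rewrite ltey_eq fin_num_measure.
have Nfin : N setT < +oo by rewrite ltey_eq fin_num_measure.
have [intP intN] := (bounded_integrable Pfin, bounded_integrable Nfin).
have [int1 int2] := (bounded_integrable fin1, bounded_integrable fin2).
have : \int[measure_add P mu2]_x (f x)%:E = \int[measure_add mu1 N]_x (f x)%:E.
  apply: eq_measure_integral => A mA _.
  rewrite -[LHS]/(measure_add P mu2 A) -[RHS]/(measure_add mu1 N A).
  rewrite !measure_addE -nuE//.
  rewrite (jordan_decomp nuPN mA) /cadd/= cscaleN1/= -/P -/N.
  by rewrite [RHS]addeAC subeK// fin_num_measure.
rewrite !integral_measure_add// => eqPN.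
have fineE (mu : {measure set (plane R) -> \bar R}) :
    mu.-integrable setT (EFin \o f) ->
    {r : R | \int[mu]_x (f x)%:E = r%:E}.
  by move=> intmu; exists (fine (\int[mu]_x (f x)%:E)); rewrite fineK//;
    exact: integrable_fin_num.
move: eqPN; case: (fineE _ intP) (fineE _ intN) (fineE _ int1) (fineE _ int2) =>
  [p ->] [n ->] [m1 ->] [m2 ->].
rewrite -!EFinD => -[eqPN]; congr EFin.
by apply/eqP; rewrite subr_eq addrAC eq_sym subr_eq eqPN.
Qed.

Lemma charge_integral0 : charge_integral (zero_charge R) f = 0.
Proof.
rewrite (@charge_integralE _ mzero mzero)//= ?/mzero ?ltry//.
  by rewrite !integral_measure_zero sube0.
by move=> A _; rewrite /czero adde0.
Qed.

(** The sum of two Jordan decompositions need not be the Jordan decomposition of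
    the sum, but it still writes the sum as a difference of finite measures. *)
Lemma charge_integralD nu1 nu2 :
  charge_integral (charge_add nu1 nu2) f =
  charge_integral nu1 f + charge_integral nu2 f.
Proof.
rewrite [in RHS]/charge_integral.
set h1 := svalP (cid (svalP (cid (Hahn_decomposition nu1)))).
set h2 := svalP (cid (svalP (cid (Hahn_decomposition nu2)))).
have fin (mu : {finite_measure set (plane R) -> \bar R}) : mu setT < +oo.
  by rewrite ltey_eq fin_num_measure.
have int (mu : {finite_measure set (plane R) -> \bar R}) :
  mu.-integrable setT (EFin \o f) by apply: bounded_integrable; exact: fin.
have addfin (mu mu' : {finite_measure set (plane R) -> \bar R}) :
    (measure_add mu mu' : {measure set (plane R) -> \bar R}) setT < +oo.
  rewrite -[X in X < _]/(measure_add mu mu' setT) measure_addE.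
  by apply: lte_add_pinfty; exact: fin.
rewrite (@charge_integralE _ (measure_add (jordan_pos h1) (jordan_pos h2))
  (measure_add (jordan_neg h1) (jordan_neg h2))).
- rewrite !integral_measure_add//; try exact: int.
  rewrite fin_num_oppeD; last by rewrite integrable_fin_num//; exact: int.
  by rewrite addeACA.
- exact: addfin.
- exact: addfin.
- move=> A mA.
  rewrite -[X in _ + X]/(measure_add (jordan_neg h1) (jordan_neg h2) A).
  rewrite -[RHS]/(measure_add (jordan_pos h1) (jordan_pos h2) A).
  rewrite !measure_addE /= /cadd.
  rewrite (jordan_decomp h1 mA) (jordan_decomp h2 mA) /cadd /= !cscaleN1/=.
  have fA (mu : {finite_measure set (plane R) -> \bar R}) : mu A \is a fin_num.
    exact: fin_num_measure.
  rewrite [X in X + _]addeACA -oppeD ?fin_num_adde_defr//.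
  by rewrite subeK// fin_numD !fA.
Qed.

Lemma charge_integral_sum (I : Type) (s : seq I)
    (nu : I -> {charge set (plane R) -> \bar R}) :
  charge_integral (\big[@charge_add R/zero_charge R]_(i <- s) nu i) f =
  \sum_(i <- s) charge_integral (nu i) f.
Proof.
elim: s => [|i s IH]; first by rewrite !big_nil charge_integral0.
by rewrite !big_cons charge_integralD IH.
Qed.

Lemma charge_integral_point_vortex (B : vdisc R) :
  charge_integral (point_vortex B) f = ((vdegree B)%:~R * f (vcenter B))%:E.
Proof.
set d : R := (vdegree B)%:~R; set a := vcenter B.
(* The positive and negative parts of the degree, as masses at the centre. *)
have maxK (x : R) : (0 <= Num.max x 0)%R by rewrite le_max lexx orbT.
pose m (x : R) : {finite_measure set (plane R) -> \bar R} :=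
  mscale (NngNum (maxK x)) \d_a.
have intd : (\d_a : {measure set (plane R) -> \bar R}).-integrable setT (EFin \o f).
  by apply: bounded_integrable; rewrite -[X in X < _]/(\d_a setT) diracT ltry.
have mE x : \int[m x]_y (f y)%:E = (Num.max x 0 * f a)%:E.
  rewrite integral_mscale// integral_dirac//; last exact/measurable_EFinP.
  by rewrite diracT mul1e.
have dE : d = (Num.max d 0 - Num.max (- d) 0)%R.
  by case: (leP d 0)%R => d0; case: (leP (- d) 0)%R => d0';
    rewrite ?subr0 ?sub0r ?opprK//; lra.
rewrite (@charge_integralE _ (m d) (m (- d)%R)) ?mE.
- by rewrite -EFinB -mulrBl -dE.
- by rewrite ltey_eq fin_num_measure.
- by rewrite ltey_eq fin_num_measure.
- move=> A mA; rewrite /= /cscale /mscale /= /charge_of_finite_measure -/d -/a.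
  by rewrite diracE -!EFinM -EFinD -mulrDl {1}dE subrK.
Qed.

End charge_integral.

(** * Lattice squares *)

Section squares.
Context (R : realType).
Implicit Types (d : R) (j : int * int) (x : plane R) (A U : set (plane R)).

(** The open lattice squares leave out the grid lines; their closures cover the
    plane and have the same measure, which avoids null sets altogether. *)
Definition closed_square d j : set (plane R) :=
  [set x | `|x.1 - (sq_center d j).1| <= d / 2 /\
           `|x.2 - (sq_center d j).2| <= d / 2].

Lemma squareE d j : square d j =
  `](sq_center d j).1 - d / 2, (sq_center d j).1 + d / 2[%classic `*`
  `](sq_center d j).2 - d / 2, (sq_center d j).2 + d / 2[%classic.
Proof.
by apply/seteqP; split=> -[x y]; rewrite /square /= !in_itv/= !ltr_distl.
Qed.

Lemma closed_squareE d j : closed_square d j =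
  `[(sq_center d j).1 - d / 2, (sq_center d j).1 + d / 2]%classic `*`
  `[(sq_center d j).2 - d / 2, (sq_center d j).2 + d / 2]%classic.
Proof.
by apply/seteqP; split=> -[x y]; rewrite /closed_square /= !in_itv/= !ler_distl.
Qed.

Lemma measurable_square d j : measurable (square d j).
Proof.
by rewrite squareE; apply: measurableX; exact: measurable_itv.
Qed.

Lemma measurable_closed_square d j : measurable (closed_square d j).
Proof.
by rewrite closed_squareE; apply: measurableX; exact: measurable_itv.
Qed.

Lemma leb2_setX (A B : set (measurableTypeR R)) :
  measurable A -> measurable B ->
  leb2 R (A `*` B) = (lebesgue_measure A * lebesgue_measure B)%E.
Proof. exact: product_measure1E. Qed.

Lemma leb2_square d j : 0 < d -> leb2 R (square d j) = (d ^+ 2)%:E.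
Proof.
move=> d0; rewrite squareE leb2_setX; try exact: measurable_itv.
rewrite !lebesgue_measure_itv/= !lte_fin.
rewrite !ifT; try by rewrite ltrD2l; lra.
by rewrite -!EFinB -EFinM; congr EFin; field.
Qed.

Lemma leb2_closed_square d j : 0 < d -> leb2 R (closed_square d j) = (d ^+ 2)%:E.
Proof.
move=> d0; rewrite closed_squareE leb2_setX; try exact: measurable_itv.
rewrite !lebesgue_measure_itv/= !lte_fin.
rewrite !ifT; try by rewrite ltrD2l; lra.
by rewrite -!EFinB -EFinM; congr EFin; field.
Qed.

Lemma square_inj d j j' x : 0 < d -> square d j x -> square d j' x -> j = j'.
Proof.
move=> d0.
have near_uniq (a b : int) (t : R) :
    `|t - d * a%:~R| < d / 2 -> `|t - d * b%:~R| < d / 2 -> a = b.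
  rewrite !ltr_distl => /andP[ta1 ta2] /andP[tb1 tb2].
  have lt1 (m n : int) : d * m%:~R - d / 2 < d * n%:~R + d / 2 -> (m <= n)%R.
    move=> mn; rewrite -ltzD1 -(ltr_int R) intrD -(ltr_pM2l d0).
    by rewrite mulrDr; lra.
  by apply/eqP; rewrite eq_le; apply/andP; split; apply: lt1; lra.
case: j j' => [a1 a2] [b1 b2] [/= xa1 xa2] [/= xb1 xb2].
by rewrite (near_uniq _ _ _ xa1 xb1) (near_uniq _ _ _ xa2 xb2).
Qed.

(** Rounding each coordinate of [x / d] to a nearest integer. *)
Lemma closed_square_cover d x : 0 < d -> exists j, closed_square d j x.
Proof.
move=> d0.
have round (t : R) : exists a : int, `|t - d * a%:~R| <= d / 2.
  exists (Num.floor (t / d + 2^-1)).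
  have /andP[] := floor_itv (t / d + 2^-1).
  rewrite -(ler_pM2l d0) -(ltr_pM2l d0) intrD !mulrDr mulrCA divff ?gt_eqF//.
  by rewrite mulr1 => lo hi; rewrite ler_distl; apply/andP; split; lra.
have [a xa] := round x.1; have [b xb] := round x.2.
by exists (a, b).
Qed.

Lemma ball_planeP x (e : R) (y : plane R) :
  ball x e y <-> `|x.1 - y.1| < e /\ `|x.2 - y.2| < e.
Proof. by []. Qed.

Lemma closed_square_ball d j x y : 0 < d ->
  closed_square d j x -> closed_square d j y -> ball x (2 * d) y.
Proof.
move=> d0 [x1 x2] [y1 y2]; apply/ball_planeP; split.
  move: x1 y1; rewrite !ler_distl ltr_distl => /andP[? ?] /andP[? ?].
  by apply/andP; split; lra.
move: x2 y2; rewrite !ler_distl ltr_distl => /andP[? ?] /andP[? ?].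
by apply/andP; split; lra.
Qed.

Lemma square_center d j : 0 < d -> square d j (sq_center d j).
Proof. by move=> d0; split; rewrite subrr normr0 divr_gt0. Qed.

Lemma square_ball_center d j x : 0 < d ->
  square d j x -> ball (sq_center d j) d x.
Proof.
move=> d0 [x1 x2]; apply/ball_planeP.
by split; rewrite distrC; [apply: lt_trans x1 _|apply: lt_trans x2 _]; lra.
Qed.

Lemma open_ball_sub A x : open A -> A x -> exists2 r : R, 0 < r & ball x r `<=` A.
Proof.
move=> oA Ax; have : nbhs x A by exact: open_nbhs_nbhs.
by rewrite -nbhs_ballE => -[r /= r0 rA]; exists r.
Qed.

(** An open set is the countable union of the closed squares of the lattices of
    side [1 / (n + 1)] that it contains, and these are products of intervals, so
    measurable for the product structure. *)
Lemma plane_open_measurable A : open A -> measurable A.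
Proof.
move=> oA; pose F (p : nat * (int * int)) : set (plane R) :=
  if `[< closed_square p.1.+1%:R^-1 p.2 `<=` A >]
  then closed_square p.1.+1%:R^-1 p.2 else set0.
rewrite (_ : A = \bigcup_p F p); last first.
  apply/seteqP; split=> [x Ax|x [p _]]; last first.
    by rewrite /F; case: asboolP => // sA; exact: sA.
  have [r r0 rA] := open_ball_sub oA Ax.
  have [n nr] : exists n : nat, n.+1%:R^-1 < r / 2.
    have r2 : 0 < r / 2 by rewrite divr_gt0.
    have /= [n _ /(_ n (leqnn n))] := near_infty_natSinv_lt (PosNum r2).
    by exists n.
  have n0 : 0 < n.+1%:R^-1 :> R by rewrite invr_gt0 ltr0n.
  have [j xj] := closed_square_cover x n0.
  exists (n, j) => //; rewrite /F; case: asboolP => // -[] y /= yj.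
  apply: rA; apply: le_ball (closed_square_ball n0 xj yj).
  by rewrite mulrC -ler_pdivlMr// ltW.
apply: (countable_bigcupT_measurable (F := F)); first exact: countableP.
by move=> p; rewrite /F; case: ifP => _; [exact: measurable_closed_square|].
Qed.

Lemma plane_continuous_measurable (f : plane R -> R) :
  continuous f -> measurable_fun setT f.
Proof.
move=> /continuousP cf; apply: (measurability _ (RGenOpens.measurableE R)).
move=> _ [_ [a [b ->] <-]]; rewrite setTI; apply: plane_open_measurable.
exact/cf/interval_open.
Qed.

End squares.

(** * Exhausting a bounded open set by lattice squares *)

Section exhaustion.
Context (R : realType).
Implicit Types (d K r : R) (j : int * int) (x : plane R) (U : set (plane R)).

(** Points at sup-distance at least [r] from the complement of [U]. *)
Definition erosion U r : set (plane R) := [set x | ball x r `<=` U].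

Definition lattice_squares U d : set (int * int) :=
  [set j | square d j `<=` U].

Definition box K : set (plane R) :=
  [set x | `|x.1| <= K /\ `|x.2| <= K].

Lemma boxE K : box K = `[- K, K]%classic `*` `[- K, K]%classic.
Proof. by apply/seteqP; split=> -[x y]; rewrite /box /= !in_itv/= !ler_norml. Qed.

Lemma box_compact K : compact (box K).
Proof. by rewrite boxE; apply: compact_setX; exact: segment_compact. Qed.

Lemma box_leb2_lty K : (leb2 R (box K) < +oo)%E.
Proof.
rewrite boxE leb2_setX; try exact: measurable_itv.
by rewrite !lebesgue_measure_itv/=; case: ifP => _; rewrite ?mule0 -?EFinB -?EFinM ltry.
Qed.

Lemma box_measurable K : measurable (box K).
Proof. by rewrite boxE; apply: measurableX; exact: measurable_itv. Qed.

Lemma subset_box_leb2_lty U K :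
  measurable U -> U `<=` box K -> (leb2 R U < +oo)%E.
Proof.
move=> mU UK; apply: le_lt_trans (box_leb2_lty K).
by apply: le_measure; rewrite ?inE//; exact: box_measurable.
Qed.

(** Its complement is a union of open balls. *)
Lemma erosion_measurable U r : measurable (erosion U r).
Proof.
rewrite -[erosion U r]setCK; apply: measurableC; apply: plane_open_measurable.
rewrite (_ : ~` _ = \bigcup_(y in ~` U) ball y r); last first.
  apply/seteqP; split=> [x /existsNP[y /not_implyP[xy Uy]]|x [y Uy yx] xU].
    by exists y => //; exact: ball_sym.
  by apply: Uy; apply: xU; exact: ball_sym.
rewrite openE => x [y Uy] /ball_planeP[yx1 yx2].
pose e := Num.min (r - `|y.1 - x.1|) (r - `|y.2 - x.2|).
have e0 : 0 < e by rewrite lt_min !subr_gt0 yx1.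
rewrite /interior -nbhs_ballE; exists e => //= z /ball_planeP[].
rewrite !lt_min => /andP[xz1 _] /andP[_ xz2]; exists y => //; apply/ball_planeP.
by split; [apply: le_lt_trans (ler_distD x.1 _ _) _
         |apply: le_lt_trans (ler_distD x.2 _ _) _]; lra.
Qed.

(** The erosions by [1 / (n + 1)] increase to the open set [U], so continuity
    from below of the measure applies. *)
Lemma erosion_exhausts U (e : R) : open U -> (leb2 R U < +oo)%E -> 0 < e ->
  exists2 r, 0 < r & (leb2 R U <= leb2 R (erosion U r) + e%:E)%E.
Proof.
move=> oU Ufin e0; pose F n := erosion U n.+1%:R^-1.
have FU : \bigcup_n F n = U.
  apply/seteqP; split=> [x [n _ xU]|x Ux].
    by apply: xU; apply: ballxx; rewrite invr_gt0 ltr0n.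
  have [r r0 rU] := open_ball_sub oU Ux.
  have [n _ /(_ n (leqnn n)) nr] := near_infty_natSinv_lt (PosNum r0).
  by exists n => // y /(le_ball (ltW nr)); exact: rU.
have mU : measurable U by exact: plane_open_measurable.
have Fcvg : leb2 R (F n) @[n --> \oo] --> leb2 R U.
  rewrite -FU; apply: nondecreasing_cvg_mu.
  - by move=> n; exact: erosion_measurable.
  - by rewrite FU.
  - move=> n m nm; apply/subsetPset => x xn y yx; apply: xn; apply: le_ball yx.
    by rewrite lef_pV2 ?posrE ?ltr0n// ler_nat ltnS.
have Ufn : leb2 R U \is a fin_num by rewrite ge0_fin_numE.
move: Fcvg; rewrite -(fineK Ufn) => /fine_cvgP[Ffin /cvgrPdist_le/(_ _ e0) Fe].
have [n [nfin ne]] : exists n, leb2 R (F n) \is a fin_num /\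
    `|fine (leb2 R U) - fine (leb2 R (F n))| <= e.
  have [N _ HN] := filterI Ffin Fe.
  by exists N; exact: HN (leqnn N).
exists n.+1%:R^-1; first by rewrite invr_gt0 ltr0n.
rewrite -[X in (_ <= X + _)%E](fineK nfin) -EFinD lee_fin.
by move: ne; rewrite ler_distl; lra.
Qed.

Lemma lattice_squares_finite U d K : 0 < d -> U `<=` box K ->
  finite_set (lattice_squares U d).
Proof.
move=> d0 UK; pose N := Num.Def.ceil (K / d).
have fin1 : finite_set [set a : int | `|a| <= N].
  apply: (@sub_finite_set _ _
    ((fun n : nat => n%:Z) @` `I_(absz N).+1 `|`
     (fun n : nat => - n%:Z) @` `I_(absz N).+1)).
    move=> a /= aN; have aN' : (absz a < (absz N).+1)%N.
      by rewrite ltnS -lez_nat; apply: le_trans (ler_norm _); rewrite abszE.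
    case: (leP 0 a) => a0; [left|right]; exists (absz a) => //.
      by rewrite abszE ger0_norm.
    by rewrite abszE ltr0_norm// opprK.
  by rewrite finite_setU; split; exact/finite_image/finite_II.
apply: sub_finite_set (finite_setX fin1 fin1) => -[a b] /= jU.
have : box K (sq_center d (a, b)).
  by apply/UK/jU; split; rewrite subrr normr0 divr_gt0.
move=> [] /=; rewrite !normrM (gtr0_norm d0) -![d * _]mulrC -!ler_pdivlMr//.
have le1 (c : int) : `|c%:~R| <= K / d -> `|c| <= N.
  by move=> cK; rewrite -(ler_int R) intr_norm (le_trans cK)// ceil_ge.
by split; exact: le1.
Qed.

Lemma squares_trivIset (J : {fset int * int}) d : 0 < d ->
  trivIset [set` J] (square d).
Proof.
by move=> d0; apply/trivIsetP => j j' _ _ /eqP jj'; apply/seteqP; split=> // x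
  [xj xj']; exact: jj' (square_inj d0 xj xj').
Qed.

Lemma sume_const (J : {fset int * int}) (c : R) :
  (\sum_(j <- J) c%:E = (#|` J|%:R * c)%:E)%E.
Proof.
by rewrite sumEFin big_const_seq count_predT iter_addr_0 mulr_natl.
Qed.

Lemma leb2_squares d (J : {fset int * int}) : 0 < d ->
  leb2 R (\big[setU/set0]_(j <- J) square d j) = (#|` J|%:R * d ^+ 2)%:E.
Proof.
move=> d0; rewrite measure_fbigsetU; last exact: squares_trivIset.
  by rewrite -sume_const; apply: eq_bigr => j _; exact: leb2_square.
by move=> j _; exact: measurable_square.
Qed.

Lemma le_squares_leb2 U d (J : {fset int * int}) : 0 < d -> measurable U ->
  (forall j, j \in J -> square d j `<=` U) ->
  ((#|` J|%:R * d ^+ 2)%:E <= leb2 R U)%E.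
Proof.
move=> d0 mU JU; rewrite -leb2_squares//; apply: le_measure; rewrite ?inE//.
  by apply: bigsetU_measurable => j _; exact: measurable_square.
by rewrite -bigcup_seq; apply: bigcup_sub => j; exact: JU.
Qed.

(** If [d <= r], a closed square of side [d] meeting the erosion by [r] has its
    open square inside [U]; so the closed squares over [lattice_squares U d]
    cover that erosion, which has nearly full measure. *)
Lemma squares_fill U K (e : R) : open U -> U `<=` box K -> 0 < e ->
  \forall d \near 0^'+,
    (leb2 R U <= (#|` fset_set (lattice_squares U d)|%:R * d ^+ 2 + e)%:E)%E.
Proof.
move=> oU UK e0.
have Ufin : (leb2 R U < +oo)%E.
  by apply: subset_box_leb2_lty UK; exact: plane_open_measurable.
have [r r0 Ur] := erosion_exhausts oU Ufin e0.
near=> d; have d0 : 0 < d by [].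
have dr : d <= r by near: d; exact: nbhs_right_le.
have Jfin := lattice_squares_finite d0 UK.
apply: (le_trans Ur); rewrite EFinD leeD2r// -sume_const.
rewrite -(fsbig_finite _ _ Jfin).
have <- : (\sum_(j \in lattice_squares U d) leb2 R (closed_square d j) =
    \sum_(j \in lattice_squares U d) (d ^+ 2)%:E)%E.
  by apply: eq_fsbigr => j _; exact: leb2_closed_square.
apply: content_sub_fsum => //.
- by move=> j _; exact: measurable_closed_square.
- exact: erosion_measurable.
move=> x xU; have [j xj] := closed_square_cover x d0; exists j => // y yj.
apply: xU; apply: (le_ball dr); apply/ball_planeP.
move: xj yj => [x1 x2] [y1 y2]; split.
  by apply: le_lt_trans (ler_distD (sq_center d j).1 _ _) _;
    rewrite [X in _ + X]distrC; lra.
by apply: le_lt_trans (ler_distD (sq_center d j).2 _ _) _;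
  rewrite [X in _ + X]distrC; lra.
Unshelve. all: by end_near. Qed.

(** The measure missed by a family [G] of squares is what all the squares of
    [U] miss, plus the total measure of the squares outside [G]; the latter is
    at most [e] times the total measure of [G], itself at most [|U|]. *)
Lemma leb2_sub_good_squares_le U K d (e : R) (G : set (int * int)) :
  0 < d -> U `<=` box K -> 0 <= e ->
  G `<=` lattice_squares U d -> measurable U ->
  (leb2 R U <= (#|` fset_set (lattice_squares U d)|%:R * d ^+ 2 + e)%:E)%E ->
  square_count R (lattice_squares U d `\` G) <= e * square_count R G ->
  fine (leb2 R U) - #|` fset_set G|%:R * d ^+ 2 <= e * (1 + fine (leb2 R U)).
Proof.
move=> d0 UK e0 GL mU Ufill bad.
have Lfin := lattice_squares_finite d0 UK.
have Gfin := sub_finite_set GL Lfin.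
have Ufin : leb2 R U \is a fin_num.
  by rewrite ge0_fin_numE//; exact: subset_box_leb2_lty UK.
have sGL : (fset_set G `<=` fset_set (lattice_squares U d))%fset.
  by apply/fsubsetP => j; rewrite !in_fset_set// !inE; exact: GL.
have split_count : #|` fset_set (lattice_squares U d)|%:R =
    square_count R (lattice_squares U d `\` G) + square_count R G :> R.
  rewrite /square_count fset_setD// cardfsD (fsetIidPr sGL).
  by rewrite -natrD subnK// fsubset_leq_card.
(* The squares of [G] are disjoint subsets of [U]. *)
have : ((#|` fset_set G|%:R * d ^+ 2)%:E <= leb2 R U)%E.
  apply: le_squares_leb2 => // j; rewrite in_fset_set// inE; exact: GL.
move: Ufill; rewrite -(fineK Ufin) !lee_fin split_count /=.
have d2 : 0 <= d ^+ 2 by rewrite exprn_ge0// ltW.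
move: bad; rewrite /square_count => bad fill le_m.
have := ler_wpM2r d2 bad; have := ler_wpM2l e0 le_m.
rewrite mulrDl in fill; lra.
Qed.

End exhaustion.

(** * Riemann sums over squares *)

Lemma compact_uniformly_continuous (R : realType) (A : set (plane R))
    (f : plane R -> R) (e : R) : compact A -> continuous f -> 0 < e ->
  \forall d \near 0^'+, forall x y, A x -> ball x d y -> `|f x - f y| < e.
Proof.
move=> cA cf e0.
have /compact_near_coveringP cov := cA.
have : \forall d \near 0^'+, A `<=` [set x | forall y, ball x d y -> `|f x - f y| < e].
  apply: (cov _ _ (fun d x => forall y, ball x d y -> `|f x - f y| < e)) => x Ax.
  have /cvgrPdist_lt/(_ (e / 2)) := cf x; rewrite divr_gt0// => /(_ isT).
  rewrite -nbhs_ballE => -[r /= r0 rf].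
  have r2 : 0 < r / 2 by rewrite divr_gt0.
  exists (ball x (r / 2), [set d | d < r / 2]) => /=.
    by split; [exact: nbhsx_ballx|exact: nbhs_right_lt].
  move=> [x' d] /= [xx' dr] y x'y.
  have fx' : `|f x - f x'| < e / 2 by apply: rf; apply: le_ball xx'; lra.
  have fy : `|f x - f y| < e / 2.
    apply: rf; apply: (@le_ball _ _ _ (r / 2 + d)); first lra.
    exact: ball_triangle xx' x'y.
  apply: le_lt_trans (ler_distD (f x) _ _) _; rewrite distrC; lra.
by apply: filterS => d Ad x y Ax; exact: Ad.
Qed.

Section riemann_sums.
Context (R : realType).
Implicit Types (d w B eta : R) (j : int * int) (A U : set (plane R)).
Variable f : plane R -> R.
Hypotheses (mf : measurable_fun setT f) (bf : [bounded f x | x in setT]).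

Lemma integrable_on A : measurable A -> (leb2 R A < +oo)%E ->
  (leb2 R).-integrable A (EFin \o f).
Proof.
move=> mA Afin; apply: measurable_bounded_integrable => //.
  exact: measurable_funS mf.
by apply: filterS bf => M fM x _; exact: fM.
Qed.

Lemma Rintegral_dist_le A (c w : R) : measurable A -> (leb2 R A < +oo)%E ->
  (forall x, A x -> `|f x - c| <= w) ->
  `|\int[leb2 R]_(x in A) f x - c * fine (leb2 R A)| <= w * fine (leb2 R A).
Proof.
move=> mA Afin fc; have intf := integrable_on mA Afin.
have intc (k : R) : (leb2 R).-integrable A (EFin \o cst k).
  by apply: measurable_bounded_integrable => //; exact: bounded_cst.
have cstE (k : R) : k * fine (leb2 R A) = \int[leb2 R]_(x in A) k.
  by rewrite Rintegral_cst.
rewrite !cstE -RintegralB//; last exact: intc.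
have intB : (leb2 R).-integrable A (EFin \o (fun x => f x - c)).
  by rewrite (_ : _ \o _ = (EFin \o f) \- (EFin \o cst c))%E//; exact: integrableB.
apply: le_trans (le_normr_Rintegral mA intB) _.
apply: le_Rintegral => //; [exact: (integrable_norm intB)|exact: intc].
Qed.

Lemma Rintegral_squares d (J : {fset int * int}) : 0 < d ->
  \int[leb2 R]_(x in \big[setU/set0]_(j <- J) square d j) f x =
  \sum_(j <- J) \int[leb2 R]_(x in square d j) f x.
Proof.
move=> d0; rewrite /Rintegral integral_bigsetU_EFin//.
- rewrite sum_fine// => j _; apply: integrable_fin_num.
    exact: measurable_square.
  by apply: integrable_on; [exact: measurable_square|rewrite leb2_square// ltry].
- by move=> j; exact: measurable_square.
- exact: squares_trivIset.
- by apply/measurable_EFinP; exact: measurable_funS mf.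
Qed.

(** [w] bounds the oscillation of [f] on each square and [eta] the error of
    [S j] as a value for [d ^+ 2 * f (sq_center d j)], relative to the area; the
    last term accounts for the part of [U] outside the squares. *)
Lemma riemann_sum_dist_le U d (J : {fset int * int}) w B eta (S : int * int -> R) :
  0 < d -> measurable U -> (leb2 R U < +oo)%E ->
  (forall j, j \in J -> square d j `<=` U) ->
  (forall j x, j \in J -> square d j x -> `|f x - f (sq_center d j)| <= w) ->
  (forall x, U x -> `|f x| <= B) ->
  (forall j, j \in J -> `|S j - d ^+ 2 * f (sq_center d j)| <= d ^+ 2 * eta) ->
  `|\sum_(j <- J) S j - \int[leb2 R]_(x in U) f x|
    <= (eta + w) * (#|` J|%:R * d ^+ 2)
       + B * (fine (leb2 R U) - #|` J|%:R * d ^+ 2).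
Proof.
move=> d0 mU Ufin JU fw fB SJ; set N := #|` J|%:R * d ^+ 2.
set G := \big[setU/set0]_(j <- J) square d j.
have mG : measurable G by apply: bigsetU_measurable => j _; exact: measurable_square.
have GU : G `<=` U by rewrite /G -bigcup_seq; apply: bigcup_sub => j; exact: JU.
have GE : leb2 R G = N%:E by exact: leb2_squares.
have mD : measurable (U `\` G) by exact: measurableD.
have DE : leb2 R (U `\` G) = (fine (leb2 R U) - N)%:E.
  rewrite measureD// (setIidr GU) EFinB fineK ?ge0_fin_numE//.
  by congr (_ - _)%E; exact: GE.
have -> : \int[leb2 R]_(x in U) f x =
    \sum_(j <- J) \int[leb2 R]_(x in square d j) f x +
    \int[leb2 R]_(x in U `\` G) f x.
  rewrite -Rintegral_squares// -/G -Rintegral_setU ?setDUK//.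
    exact: integrable_on.
  by apply/disj_setPS => x [? []].
rewrite opprD addrA -sumrB.
apply: le_trans (ler_normB _ _) _; apply: lerD.
  apply: le_trans (ler_norm_sum _ _ _) _.
  rewrite (_ : (eta + w) * N = \sum_(j <- J) (d ^+ 2 * eta + w * d ^+ 2)); last first.
    rewrite big_const_seq count_predT iter_addr_0 -mulr_natl -/(#|` J|) /N.
    by ring.
  rewrite [leLHS]big_seq [leRHS]big_seq; apply: ler_sum => j jJ.
  have mj := measurable_square d j.
  have jfin : (leb2 R (square d j) < +oo)%E by rewrite leb2_square// ltry.
  have := Rintegral_dist_le mj jfin (fw _ ^~ jJ).
  rewrite leb2_square//= => Ij.
  apply: le_trans (ler_distD (d ^+ 2 * f (sq_center d j)) _ _) _.
  by apply: lerD; [exact: SJ|rewrite distrC [X in _ - X]mulrC].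
have := @Rintegral_dist_le _ 0 B mD.
rewrite DE ltry mul0r subr0; apply => // x [Ux _]; rewrite subr0; exact: fB.
Qed.

End riemann_sums.

(** * The contribution of one good square *)

(** Replacing every [vcenter D] by the centre of the square costs [w] times the
    total absolute degree; replacing the total degree by [Om * d ^+ 2] costs at
    most [B] times its deviation. The latter is bounded on both sides: the upper
    bound comes from the absolute degrees. *)
Lemma vortex_family_sum_dist_le (R : realType) (v : plane R -> R[i])
    (Om d C gam w B : R) (j : int * int) (s : seq (vdisc R)) (f : plane R -> R) :
  0 < Om -> 0 < d -> vortex_family v Om d C gam j s ->
  (forall x, square d j x -> `|f x - f (sq_center d j)| <= w) ->
  `|f (sq_center d j)| <= B ->
  `|Om^-1 * (\sum_(D <- s) (vdegree D)%:~R * f (vcenter D))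
    - d ^+ 2 * f (sq_center d j)| <= d ^+ 2 * (w * (1 + gam) + B * gam).
Proof.
move=> Om0 d0 [sdisc _ _ deglo deghi] fw fB.
set c := sq_center d j.
(* The radius is positive, so a disc contained in the square has its centre
   there; the other discs have degree [0]. *)
have center D : D \in s -> vdegree D != 0 -> square d j (vcenter D).
  move=> Ds D0; have [r0 [_ out]] := sdisc _ Ds.
  have [DK|DK] := pselect (vball D `<=` square d j); last by rewrite out// eqxx in D0.
  by apply: DK; rewrite /vball /disc /eucl_dist /enorm /= !subrr expr0n addr0 sqrtr0.
set T := Om * d ^+ 2 in deglo deghi *.
have TE (y : R) : d ^+ 2 * y = Om^-1 * (T * y) by rewrite /T -mulrA mulKf ?gt_eqF.
rewrite !TE -mulrBr normrM gtr0_norm ?invr_gt0// ler_pM2l ?invr_gt0//.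
have -> : \sum_(D <- s) (vdegree D)%:~R * f (vcenter D) - T * f c =
    \sum_(D <- s) (vdegree D)%:~R * (f (vcenter D) - f c) +
    ((\sum_(D <- s) vdegree D)%:~R - T) * f c.
  under [in RHS]eq_bigr do rewrite mulrBr.
  by rewrite sumrB -mulr_suml -(raddf_sum (intmul 1))/=; ring.
have abs_deg : \sum_(D <- s) `|(vdegree D)%:~R| = (\sum_(D <- s) `|vdegree D|)%:~R :> R.
  rewrite (raddf_sum (intmul 1))/=; apply: eq_bigr => D _.
  by rewrite intr_norm.
have w0 : 0 <= w.
  by apply: le_trans (normr_ge0 _) (fw c _); split; rewrite subrr normr0 divr_gt0.
apply: le_trans (ler_normD _ _) _; rewrite mulrDr; apply: lerD.
  apply: le_trans (ler_norm_sum _ _ _) _.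
  apply: (@le_trans _ _ (w * \sum_(D <- s) `|(vdegree D)%:~R|)); last first.
    by rewrite abs_deg [leRHS]mulrCA ler_wpM2l.
  rewrite mulr_sumr [leLHS]big_seq [leRHS]big_seq; apply: ler_sum => D Ds.
  rewrite normrM mulrC; have [->|D0] := eqVneq (vdegree D) 0.
    by rewrite normr0 !mulr0.
  by rewrite ler_wpM2r//; exact/fw/center.
rewrite normrM mulrCA mulrC; apply: ler_pM => //.
have : (\sum_(D <- s) vdegree D)%:~R <= (\sum_(D <- s) `|vdegree D|)%:~R :> R.
  by rewrite ler_int; apply: ler_sum => D _; exact: ler_norm.
move: deglo deghi; rewrite ler_distl !mulrDr mulrN; lra.
Qed.

(** * Bounds on the data, and the limit of the side *)

Lemma compactly_supported_bounded (R : realType) (f : plane R -> R) :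
  continuous f -> compactly_supported f ->
  exists2 B, 0 <= B & forall x, `|f x| <= B.
Proof.
move=> cf /(continuous_compact (continuous_subspaceT cf))/compact_bounded.
move=> [B [_ fB]]; exists (`|B| + 1) => [|x]; first by rewrite addr_ge0.
have [fx0|fx0] := eqVneq (f x) 0; first by rewrite fx0 normr0 addr_ge0.
apply: fB; first by rewrite ltr_pwDr// ler_norm.
by exists x => //; exact: subset_closure.
Qed.

Section bulk.
Context (R : realType).
Implicit Types Lambda eps Om M : R.

(** Under [eps * Om < 2 * Lambda <= 2] both factors of [bulk_ratio] are positive,
    so that [bulk] is a genuine ellipse. *)
Lemma bulk_Lambda_gt0 Lambda eps Om : 0 < Lambda <= 1 ->
  0 <= eps * Om -> eps * Om < 2 * Lambda -> 0 < bulk_Lambda Lambda eps Om.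
Proof.
move=> /andP[L0 L1] e0 eL; apply: mulr_gt0 => //; apply: powR_gt0.
have sq_lt : (eps * Om) ^+ 2 < 4 * Lambda ^+ 2.
  by rewrite -[4]/(2 * 2)%:R natrM -expr2 -exprMn ltr_pXn2r ?nnegrE//; lra.
apply: divr_gt0; rewrite subr_gt0 -exprMn ltr_pdivrMr ?mul1r//.
  by rewrite mulr_gt0// exprn_gt0.
apply: lt_le_trans sq_lt _; rewrite ler_piMr//.
by rewrite expr_le1// ltW.
Qed.

Lemma bulk_bounded Lambda eps Om : 0 < bulk_Lambda Lambda eps Om ->
  exists K, bulk Lambda eps Om `<=` box K.
Proof.
rewrite /bulk; set L := bulk_Lambda _ _ _; set a := bulk_alpha _ _ _ => L0.
exists ((1 + `|a|) * (1 + L^-1)) => x /= ax.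
have norm_le (t : R) : t ^+ 2 < a -> `|t| <= 1 + `|a|.
  rewrite -real_normK ?num_real// => ta; have := ler_norm a.
  have := normr_ge0 t; have := normr_ge0 a; nra.
have x1 : `|x.1| <= 1 + `|a|.
  by apply: norm_le; have := sqr_ge0 (L * x.2); rewrite exprMn; lra.
have x2 : `|L * x.2| <= 1 + `|a|.
  by apply: norm_le; have := sqr_ge0 x.1; rewrite exprMn; lra.
have Li0 : 0 <= L^-1 by rewrite invr_ge0 ltW.
have a0 := normr_ge0 a.
split; first by rewrite (le_trans x1)// ler_peMr; lra.
move: x2; rewrite normrM (gtr0_norm L0) mulrC -ler_pdivlMr// => x2.
by rewrite (le_trans x2)// ler_wpM2l; lra.
Qed.

Lemma side_gt0 eps Om : 0 < eps < 1 -> 0 < Om -> 0 < side eps Om.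
Proof.
move=> /ln_lt0 ln0 Om0; apply/powR_gt0/divr_gt0 => //.
by rewrite normr_gt0 lt_eqF.
Qed.

(** The fourth power of the side is [|ln eps| / Om eps], at most [1 / b eps]. *)
Lemma near_side (b Om : R -> R) (P : R -> Prop) :
  (forall eps, 0 < eps < 1 -> 0 < b eps) ->
  b eps @[eps --> 0^'+] --> +oo ->
  (forall eps, 0 < eps < 1 -> b eps * `|ln eps| <= Om eps) ->
  (\forall d \near 0^'+, P d) ->
  \forall eps \near 0^'+, P (side eps (Om eps)).
Proof.
move=> b0 binfty bOm [r /= r0 rP].
have r4 : 0 < r ^+ 4 by rewrite exprn_gt0.
have /cvgryPgt/(_ (r ^+ 4)^-1) bbig := binfty.
near=> eps.
have eps0 : 0 < eps by [].
have eps1 : eps < 1 by near: eps; exact: nbhs_right_lt.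
have eps01 : 0 < eps < 1 by rewrite eps0.
have l0 : 0 < `|ln eps| by rewrite normr_gt0 lt_eqF// ln_lt0.
have Om0 : 0 < Om eps by apply: lt_le_trans (bOm _ eps01); rewrite mulr_gt0// b0.
have s0 := side_gt0 eps01 Om0.
apply: rP => //=; rewrite sub0r normrN gtr0_norm//.
have rE : r = (r ^+ 4) `^ 4^-1.
  by rewrite -powR_mulrn ?ltW// -powRrM divff ?powRr1// ltW.
rewrite [ltRHS]rE; apply: gt0_ltr_powR; rewrite ?nnegrE ?invr_gt0 ?ltW//.
  exact: divr_gt0.
rewrite ltr_pdivrMr// -ltr_pdivrMl//.
apply: lt_le_trans (bOm _ eps01); rewrite ltr_pM2r//.
by near: eps.
Unshelve. all: by end_near. Qed.

End bulk.

(** * Convergence of the vorticity *)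

Theorem theorem6p1 (R : realType)
  (Lambda M beta C : R) (b Om g ghat : R -> R)
  (U : set (plane R))
  (eta : R -> plane R -> R) (v : R -> plane R -> R[i])
  (discs : R -> int * int -> seq (vdisc R)) :
  0 < Lambda <= 1 ->
  0 < M < 2 * Lambda ->
  (forall eps, 0 < eps < 1 -> 0 < b eps) ->
  b eps @[eps --> 0^'+] --> +oo ->
  (forall eps, 0 < eps < 1 -> b eps * `|ln eps| <= Om eps <= M / eps) ->
  0 < beta ->
  open U ->
  leb2 R (bdry U) = 0%E ->
  (\forall eps \near 0^'+,
     closure U `<=` bulk Lambda eps (Om eps) /\
     (beta%:E <= set_dist U (bdry (bulk Lambda eps (Om eps))))%E) ->
  (\forall eps \near 0^'+,
     positive_minimizer Lambda eps (Om eps) (eta eps)) ->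
  (\forall eps \near 0^'+,
     C0_minimizer (eta eps) eps (Om eps) (v eps)) ->
  (\forall eps \near 0^'+, 0 < g eps) ->
  g eps @[eps --> 0^'+] --> 0 ->
  (\forall eps \near 0^'+, forall j,
     squares_in U eps (Om eps) j ->
     (((1 - g eps) * GLscale eps (Om eps))%:E
      <= GL (eta eps) eps (Om eps) (v eps) j)%E) ->
  ratio_vanishes
    (fun eps => square_count R
       (bad_squares U (eta eps) eps (Om eps) (v eps) (g eps)))
    (fun eps => square_count R
       (good_squares U (eta eps) eps (Om eps) (v eps) (g eps))) ->
  0 < C ->
  (\forall eps \near 0^'+, 0 < ghat eps) ->
  ghat eps @[eps --> 0^'+] --> 0 ->
  (\forall eps \near 0^'+, forall j,
     good_squares U (eta eps) eps (Om eps) (v eps) (g eps) j ->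
     vortex_family (v eps) (Om eps) (side eps (Om eps)) C (ghat eps) j
       (discs eps j)) ->
  forall phi : plane R -> R,
    continuous phi -> compactly_supported phi ->
    ((Om eps)^-1%:E
     * charge_integral
         (vorticity
            (good_squares U (eta eps) eps (Om eps) (v eps) (g eps))
            (discs eps))
         phi)%E @[eps --> 0^'+]
    --> (\int[leb2 R]_(x in U) (phi x)%:E)%E.
Proof.
move=> L01 /andP[M0 M2L] b0 binfty bOm beta0 oU _ Ubulk _ _ _ _ _ ratio C0 _.
move=> ghat0 vortices phi cphi sphi.
have bOm1 eps : 0 < eps < 1 -> b eps * `|ln eps| <= Om eps.
  by move=> /bOm /andP[].
have [B B0 phiB] := compactly_supported_bounded cphi sphi.
have bphi : [bounded phi x | x in setT].
  exists B; split; [exact: num_real|move=> N BN x _].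
  by rewrite /= (le_trans (phiB x))// ltW.
have mphi := plane_continuous_measurable cphi.
have mU := plane_open_measurable oU.
(* A single small [eps] suffices, since [U] is fixed. *)
have [K UK] : exists K, U `<=` box K.
  have near_bulk : \forall eps \near 0^'+,
      (closure U `<=` bulk Lambda eps (Om eps) /\
       (beta%:E <= set_dist U (bdry (bulk Lambda eps (Om eps))))%E) /\ 0 < eps < 1.
    near=> eps; split; first by near: eps.
    apply/andP; split; first by [].
    by near: eps; exact: nbhs_right_lt.
  have [eps [[sU _] /andP[eps0 eps1]]] :=
    @filter_ex _ _ (at_right_proper_filter 0) _ near_bulk.
  have eps01 : 0 < eps < 1 by rewrite eps0.
  have Om0 : 0 <= Om eps.
    by apply: le_trans (bOm1 _ eps01); rewrite mulr_ge0// ltW// b0.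
  have [|K bulkK] := @bulk_bounded R Lambda eps (Om eps).
    apply: bulk_Lambda_gt0 => //; first by rewrite mulr_ge0// ltW.
    apply: le_lt_trans M2L; rewrite mulrC -ler_pdivlMr//.
    by case/andP: (bOm _ eps01).
  by exists K => x Ux; apply/bulkK/sU; exact: subset_closure.
have Ufin : (leb2 R U < +oo)%E by exact: subset_box_leb2_lty UK.
set m := fine (leb2 R U).
have m0 : 0 <= m by exact: fine_ge0.
rewrite -[X in _ --> X]fineK; last exact/integrable_fin_num/integrable_on.
under eq_cvg => eps.
  rewrite /vorticity charge_integral_sum//.
  under eq_bigr => j _.
    rewrite charge_integral_sum//.
    under eq_bigr do rewrite charge_integral_point_vortex//.
    rewrite sumEFin; over.
  rewrite sumEFin -EFinM mulr_sumr; over.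
apply: cvg_EFin; first by near=> eps.
apply/cvgrPdist_le => e e0.
(* With [t] bounding [ghat], the oscillation of [phi] on a square, the measure
   missed by all the squares and the ratio of bad to good ones, the total error
   is at most [t * D]. *)
pose D := (B + 3) * m + B * (1 + m) + 1.
have D0 : 0 < D by rewrite /D ltr_wpDl// addr_ge0// mulr_ge0// addr_ge0.
pose t := Num.min 1 (e / D).
have t0 : 0 < t by rewrite lt_min ltr01 divr_gt0.
have t1 : t <= 1 by rewrite ge_min lexx.
have tD : t * D <= e by rewrite -ler_pdivlMr// ge_min lexx orbT.
have fill := near_side b0 binfty bOm1 (squares_fill oU UK t0).
have unif := near_side b0 binfty bOm1
  (compact_uniformly_continuous (@box_compact R K) cphi t0).
have small_ghat : \forall eps \near 0^'+, `|ghat eps| <= t.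
  by have /cvgr0_norm_le/(_ _ t0) := ghat0.
near=> eps.
have eps01 : 0 < eps < 1.
  apply/andP; split; first by [].
  by near: eps; exact: nbhs_right_lt.
have Om0 : 0 < Om eps.
  apply: lt_le_trans (bOm1 _ eps01); rewrite mulr_gt0 ?b0//.
  by rewrite normr_gt0 lt_eqF// ln_lt0.
rewrite /=; set d := side eps (Om eps); have d0 : 0 < d by exact: side_gt0.
set G := good_squares _ _ _ _ _ _.
have GL : G `<=` lattice_squares U d by move=> j [].
have Gfin : finite_set G := sub_finite_set GL (lattice_squares_finite d0 UK).
have GU j : j \in fset_set G -> square d j `<=` U.
  by rewrite in_fset_set// inE => /GL.
have close j x : j \in fset_set G -> square d j x ->
    `|phi x - phi (sq_center d j)| <= t.
  move=> jG xj; rewrite distrC ltW//.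
  have unif_eps : forall x y, box K x -> ball x (side eps (Om eps)) y ->
    `|phi x - phi y| < t by near: eps; exact: unif.
  apply: unif_eps; last exact: square_ball_center.
  exact/UK/(GU j jG)/square_center.
have ghat_le : `|ghat eps| <= t by near: eps.
have vortex_sum j : j \in fset_set G ->
    `|(Om eps)^-1 * (\sum_(D <- discs eps j) (vdegree D)%:~R * phi (vcenter D))
      - d ^+ 2 * phi (sq_center d j)| <= d ^+ 2 * (t * (B + 2)).
  move=> jG; have vj : vortex_family (v eps) (Om eps) d C (ghat eps) j (discs eps j).
    move: jG; rewrite in_fset_set// inE; move: j; rewrite /G /d.
    by near: eps; exact: vortices.
  have := vortex_family_sum_dist_le Om0 d0 vj (fun x => close j x jG) (phiB _).
  move=> /le_trans; apply; rewrite ler_pM2l ?exprn_gt0//.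
  have gt : ghat eps <= t := le_trans (ler_norm _) ghat_le.
  have := ler_wpM2l (ltW t0) (le_trans gt t1); have := ler_wpM2l B0 gt.
  by clearbody t; lra.
have := riemann_sum_dist_le mphi bphi d0 mU Ufin GU close (fun x _ => phiB x) vortex_sum.
rewrite distrC => /le_trans; apply; apply: le_trans tD.
have Nm : #|` fset_set G|%:R * d ^+ 2 <= m.
  by rewrite -lee_fin fineK ?ge0_fin_numE// le_squares_leb2.
have mN : m - #|` fset_set G|%:R * d ^+ 2 <= t * (1 + m).
  apply: (leb2_sub_good_squares_le d0 UK (ltW t0) GL) => //.
    by rewrite /d; near: eps; exact: fill.
  by rewrite /d /G; near: eps; exact: ratio.
have : (t * (B + 2) + t) * (#|` fset_set G|%:R * d ^+ 2) <= (t * (B + 2) + t) * m.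
  by rewrite ler_wpM2l//; nra.
have : B * (m - #|` fset_set G|%:R * d ^+ 2) <= B * (t * (1 + m)).
  by rewrite ler_wpM2l.
by rewrite -/m /D; clearbody t; lra.
Unshelve. all: by end_near. Qed.
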